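(* Let $a,b,c,\gamma,\alpha,\lambda>0$. For $0<x<1$ define $$G(x)=\int_0^{Q_Y(F_X(x))} f_T(t)\,dt,$$ where $F_X$ is the Kumaraswamy$(a,b)$ cumulative distribution function, $Q_Y$ is the Lomax$(\alpha,\lambda)$ quantile function, and $f_T$ is the Weibull$(c,\gamma)$ density. Then the distribution on $(0,1)$ with cumulative distribution function $G$ satisfies the following, for all $0<x<1$ and $0<u<1$. (1) Its cumulative distribution function is $$G(x)=1-\exp\left[-\left(\frac{\lambda\left[(1-x^a)^{-b/\alpha}-1\right]}{\gamma}\right)^c\right].$$ (2) Its probability density function is $$g(x)=\frac{abc\lambda}{\alpha\gamma}\,x^{a-1}(1-x^a)^{-1-\frac{b}{\alpha}}\left(\frac{\lambda\left[(1-x^a)^{-b/\alpha}-1\right]}{\gamma}\right)^{c-1}\exp\left[-\left(\frac{\lambda\left[(1-x^a)^{-b/\alpha}-1\right]}{\gamma}\right)^c\right].$$ (3) Its quantile function is $$Q(u)=\left[1-\left\{1+\frac{\gamma}{\lambda}\left[-\ln(1-u)\right]^{1/c}\right\}^{-\alpha/b}\right]^{1/a}.$$ (4) Its hazard function $h=g/(1-G)$ is $$h(x)=\frac{abc\lambda}{\alpha\gamma}\,x^{a-1}(1-x^a)^{-1-\frac{b}{\alpha}}\left(\frac{\lambda\left[(1-x^a)^{-b/\alpha}-1\right]}{\gamma}\right)^{c-1}.$$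
   Context: The Weibull$(c,\gamma)$ distribution (shape $c>0$, scale $\gamma>0$) has density $f_T(t)=\frac{c}{\gamma}\left(\frac{t}{\gamma}\right)^{c-1}e^{-(t/\gamma)^c}$ for $t>0$ and cumulative distribution function $F_T(t)=1-e^{-(t/\gamma)^c}$. The Kumaraswamy$(a,b)$ distribution ($a,b>0$) has density $f_X(x)=abx^{a-1}(1-x^a)^{b-1}$ and cumulative distribution function $F_X(x)=1-(1-x^a)^b$ for $0<x<1$. The Lomax$(\alpha,\lambda)$ distribution ($\alpha,\lambda>0$) has density $f_Y(y)=\frac{\alpha}{\lambda}\left[1+\frac{y}{\lambda}\right]^{-(\alpha+1)}$ and cumulative distribution function $F_Y(y)=1-\left[1+\frac{y}{\lambda}\right]^{-\alpha}$ for $y>0$, and quantile function $Q_Y(p)=\lambda\left[(1-p)^{-1/\alpha}-1\right]$ for $0<p<1$. The quantile function of the distribution with cumulative distribution function $G$ is the inverse function of $G$ on $(0,1)$. The distribution with cumulative distribution function $G$ is called the Weibull-Kumaraswamy-{Lomax} distribution. *)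

(* Defs.v *)
From HB Require Import structures.
From mathcomp Require Import all_boot all_order all_algebra.
From mathcomp Require Import all_classical all_reals all_analysis.

Set Implicit Arguments.
Unset Strict Implicit.
Unset Printing Implicit Defensive.

Import Order.TTheory GRing.Theory Num.Theory.
Import numFieldNormedType.Exports.

Local Open Scope classical_set_scope.
Local Open Scope ring_scope.

Definition weibull_pdf (R : realType) (c gamma t : R) : R :=
  if 0 < t then
    c / gamma * (t / gamma) `^ (c - 1) * expR (- ((t / gamma) `^ c))
  else 0.

(* Meaningful for 0 < x < 1 only: powR takes default values at negative
   bases. *)
Definition kumaraswamy_cdf (R : realType) (a b x : R) : R :=
  1 - (1 - x `^ a) `^ b.

(* Meaningful for 0 < p < 1 only. *)
Definition lomax_quantile (R : realType) (alpha lambda p : R) : R :=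
  lambda * ((1 - p) `^ (- (1 / alpha)) - 1).

(* A Lebesgue integral, as the Weibull density is unbounded near 0 when
   c < 1. *)
Definition wkl_G (R : realType) (a b c gamma alpha lambda x : R) : R :=
  \int[lebesgue_measure]_(t in
      `[0, lomax_quantile alpha lambda (kumaraswamy_cdf a b x)])
    weibull_pdf c gamma t.

(* A distribution on the real line is a Borel probability measure P; its
   cumulative distribution function is the one of the identity, seen as a
   random variable on the probability space (R, P). *)
Definition idR (R : realType) : measurableTypeR R -> R := idfun.

HB.instance Definition _ (R : realType) :=
  @isMeasurableFun.Build _ _ _ _ (@idR R) (@measurable_id _ _ setT).

Definition dist_cdf (R : realType) (P : probability (measurableTypeR R) R)
    (x : R) : R :=
  fine (cdf (@idR R : {RV P >-> R}) x).

Definition distribution_on01_with_cdf (R : realType) (G : R -> R)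
    (P : probability (measurableTypeR R) R) : Prop :=
  P `]0%R, 1%R[%classic = 1%E /\ forall x : R, 0 < x < 1 -> dist_cdf P x = G x.

(* The first three clauses say that g is a density with respect to Lebesgue
   measure, which determines g only almost everywhere; the last one fixes its
   value at every point of (0, 1). *)
Definition pdf_on01 (R : realType) (P : probability (measurableTypeR R) R)
    (g : R -> R) : Prop :=
  [/\ measurable_fun (`]0, 1[ : set R) g,
      forall x : R, 0 < x < 1 -> 0 <= g x,
      forall A : set R, measurable A ->
        P A = (\int[lebesgue_measure]_(x in A `&` `]0%R, 1%R[) (g x)%:E)%E
    & forall x : R, 0 < x < 1 -> is_derive x 1 (dist_cdf P) (g x)].

(* Q is the inverse of the bijection from (0, 1) to (0, 1) induced by F. *)
Definition quantile_function_on01 (R : realType) (F Q : R -> R) : Prop :=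
  (forall u : R, 0 < u < 1 -> 0 < Q u < 1 /\ F (Q u) = u) /\
  (forall x : R, 0 < x < 1 -> 0 < F x < 1 /\ Q (F x) = x).

Definition hazard (R : realType) (F g : R -> R) (x : R) : R :=
  g x / (1 - F x).

(* Main.v *)
Require Import Defs.
From HB Require Import structures.
From mathcomp Require Import all_boot all_order all_algebra.
From mathcomp Require Import all_classical all_reals all_analysis.
From mathcomp Require Import measurable_realfun ring lra.

Set Implicit Arguments.
Unset Strict Implicit.
Unset Printing Implicit Defensive.

Import Order.TTheory GRing.Theory Num.Theory.
Import numFieldNormedType.Exports.

Local Open Scope classical_set_scope.
Local Open Scope ring_scope.

(** With z(x) = lambda ((1 - x^a)^(-b/alpha) - 1) / gamma, a positive function
    on (0, 1), the distribution function is x |-> 1 - exp(-z(x)^c), and its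
    quantile function is obtained by inverting each elementary factor. Since a
    nondecreasing bijection of (0, 1) tends to 0 and 1 at the end points, the
    fundamental theorem of calculus on an open interval shows that the
    derivative of this bijection is a probability density on (0, 1), whence
    existence; as a cumulative distribution function determines the
    probability, every distribution with this one has that density. *)

(** * The fundamental theorem of calculus on an open interval *)

Lemma is_derive_continuous (R : realType) (f : R -> R) (x df : R) :
  is_derive x 1 f df -> {for x, continuous f}.
Proof. by case=> dfx _; apply/differentiable_continuous/derivable1_diffP. Qed.

Lemma itv_oo_bigcup_cc (R : realType) (u v : R) :
  `]u, v[%classic = \bigcup_n `[u + n.+1%:R^-1, v - n.+1%:R^-1]%classic.
Proof.
apply/seteqP; split => [x|x [n _]] /=; rewrite !in_itv/=; last first.
  have d0 : 0 < n.+1%:R^-1 :> R by rewrite invr_gt0 ltr0n.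
  by move: d0; set d := _^-1 => d0 /andP[ux xv]; apply/andP; split; lra.
move=> /andP[ux xv].
have e0 : 0 < Num.min (x - u) (v - x) by rewrite lt_min !subr_gt0 ux.
have [n _ /(_ _ (leqnn n))] :=
  (cvgrPdist_lt _ _).1 (@cvg_harmonic R) _ e0.
rewrite /harmonic/= sub0r normrN gtr0_norm ?invr_gt0 ?ltr0n// lt_min => h.
exists n => //=; rewrite in_itv/=; move: h; set d := _^-1 => /andP[dx dv].
by apply/andP; split; lra.
Qed.

(** Only one-sided limits of [F] are asked for, so [f] may be unbounded near either end point. The
    interval is exhausted by the closed intervals [I n]: Newton-Leibniz holds on each, and since [f]
    is nonnegative, monotone convergence carries the integrals to the limit. *)
Lemma ge0_continuous_FTC2_oo (R : realType) (f F : R -> R) (u v l r : R) :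
  u < v -> (forall x : R, u < x < v -> 0 <= f x) ->
  {in `]u, v[, continuous f} ->
  (forall x : R, u < x < v -> is_derive x 1 F (f x)) ->
  F x @[x --> u^'+] --> l -> F x @[x --> v^'-] --> r ->
  (\int[lebesgue_measure]_(x in `]u, v[) (f x)%:E = (r - l)%:E)%E.
Proof.
move=> uv f0 cf dF Fl Fr.
pose d n : R := n.+1%:R^-1.
have d0 n : 0 < d n by rewrite invr_gt0 ltr0n.
have dcvg : d n @[n --> \oo] --> 0 by exact: cvg_harmonic.
pose I n := `[u + d n, v - d n]%classic.
have Iuv n : I n `<=` `]u, v[%classic.
  move=> x; rewrite /I/= !in_itv/= => /andP[ux xv]; have := d0 n.
  by move=> dn; apply/andP; split; lra.
have cFI : (\int[lebesgue_measure]_(x in I n) (f x)%:E)%E @[n --> \oo] -->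
    (\int[lebesgue_measure]_(x in `]u, v[) (f x)%:E)%E.
  rewrite itv_oo_bigcup_cc; apply: ge0_nondecreasing_set_cvg_integral.
  - move=> m n mn; apply/subsetPset => x; rewrite /I/= !in_itv/=.
    have dnm : d n <= d m by rewrite lef_pV2 ?posrE ?ltr0n// ler_nat.
    by move=> /andP[ux xv]; apply/andP; split; lra.
  - by move=> n; exact: measurable_itv.
  - move=> n; apply/measurable_EFinP.
    apply: (@measurable_funS _ _ _ _ `]u, v[%classic) => //.
    apply: open_continuous_measurable_fun => //.
    by move=> x; rewrite inE; exact: cf.
  - by move=> n x /Iuv /=; rewrite in_itv/= lee_fin => /f0.
have cFrl : (F (v - d n) - F (u + d n))%:E @[n --> \oo] --> (r - l)%:E.
  apply: cvg_EFin; first exact: nearW.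
  apply: cvgB.
  - apply: ((cvg_at_leftP F v r).1 Fr (fun n => v - d n)); split.
    + by move=> n; rewrite ltrBlDr ltrDl.
    + by rewrite -[X in _ --> X]subr0; apply: cvgB => //; exact: cvg_cst.
  - apply: ((cvg_at_rightP F u l).1 Fl (fun n => u + d n)); split.
    + by move=> n; rewrite ltrDl.
    + by rewrite -[X in _ --> X]addr0; apply: cvgD => //; exact: cvg_cst.
suff : (\int[lebesgue_measure]_(x in I n) (f x)%:E)%E @[n --> \oo] -->
    (r - l)%:E by move: cFI; exact: cvg_unique.
apply: cvg_trans cFrl; apply: near_eq_cvg.
near=> n.
(* For small [n] the interval [I n] may be empty; the closed-interval theorem needs ordered end
   points, which hold for all large [n]. *)
have uvn : u + d n < v - d n.
  have : d n < (v - u) / 2.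
    near: n; apply: (cvgr_lt _ dcvg).
    by rewrite divr_gt0// subr_gt0.
  lra.
have sub x : u + d n <= x <= v - d n -> u < x < v.
  by move=> /andP[ux xv]; have dn := d0 n; apply/andP; split; lra.
have cF x : u + d n <= x <= v - d n -> {for x, continuous F}.
  by move=> /sub/dF/is_derive_continuous.
rewrite /I (@continuous_FTC2 _ f F)//.
- apply: continuous_in_subspaceT => x; rewrite inE/= in_itv/= => /sub xuv.
  by apply: cf; rewrite in_itv.
- split.
  + move=> x; rewrite in_itv/= => /andP[ux xv].
    by have [] := dF x (sub _ _); [rewrite !ltW|].
  + by apply: cvg_at_right_filter; apply: cF; rewrite lexx ltW.
  + by apply: cvg_at_left_filter; apply: cF; rewrite lexx ltW.
- move=> x; rewrite in_itv/= => /andP[ux xv]; rewrite derive1E.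
  by have [] := dF x (sub _ _); [rewrite !ltW|].
Unshelve. all: by end_near. Qed.

(** * Probabilities given by a density, and uniqueness from the distribution function *)

Lemma exists_probability_density (R : realType) (D : set R) (f : R -> R) :
  measurable D -> measurable_fun D f -> (forall x, D x -> 0 <= f x) ->
  (\int[lebesgue_measure]_(x in D) (f x)%:E = 1)%E ->
  exists P : probability (measurableTypeR R) R,
    forall A : set R, measurable A ->
      P A = (\int[lebesgue_measure]_(x in A `&` D) (f x)%:E)%E.
Proof.
move=> mD mf f0 f1.
(* Extension by zero gives a nonnegative measurable function on the whole line, whose integral is a
   measure; [mE] then returns to integrals over [D]. *)
pose h := (f \_ D).
have mh : measurable_fun [set: R] h by exact/(measurable_restrictT _ _).1.
have h0 x : 0 <= h x.
  by rewrite /h patchE; case: ifPn => // /set_mem /f0.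
pose m (A : set (measurableTypeR R)) : \bar R :=
  (\int[lebesgue_measure]_(x in A) (h x)%:E)%E.
have m0 : m set0 = 0%E by rewrite /m integral_set0.
have m_ge0 A : (0 <= m A)%E.
  by apply: integral_ge0 => x _; rewrite lee_fin.
have m_sigma : semi_sigma_additive m.
  (* The partial sums are nondecreasing, hence convergent, so it remains to identify their limit. *)
  move=> F mF tF mUF; rewrite /m; apply: cvg_toP.
    apply: ereal_nondecreasing_is_cvgn => i n mn.
    apply: lee_sum_nneg_natr => // k _ _; apply: integral_ge0 => /= x Fkx.
    by rewrite lee_fin.
  rewrite ge0_integral_bigcup//=.
  - by apply: measurable_funTS; exact/measurable_EFinP.
  - by move=> x _; rewrite lee_fin.
have mE (A : set R) :
    m A = (\int[lebesgue_measure]_(x in A `&` D) (f x)%:E)%E.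
  by rewrite /m integral_mkcondr restrict_EFin.
have mT : m setT = 1%E by rewrite mE setTI.
pose mu : {measure set (measurableTypeR R) -> \bar R} :=
  HB.pack m (isMeasure.Build _ _ _ m m0 m_ge0 m_sigma).
pose P : probability (measurableTypeR R) R :=
  HB.pack m (Measure.on mu) (Measure_isProbability.Build _ _ _ mu mT).
by exists P.
Qed.

(** A probability is the Lebesgue-Stieltjes measure of its distribution function, and such a measure
    is determined by its values on half-open intervals. These are differences of rays, whose masses
    are values of the distribution function. *)
Lemma probability_eq_cdf (R : realType)
    (P Q : probability (measurableTypeR R) R) :
  dist_cdf P =1 dist_cdf Q ->
  forall A : set R, measurable A -> P A = Q A.
Proof.
move=> PQ A mA; rewrite -[LHS](lebesgue_stieltjes_cdf_id P mA).
apply: lebesgue_stieltjes_measure_unique => // X oX.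
have mX : measurable (X : set (measurableTypeR R)).
  exact: sub_sigma_algebra.
rewrite (lebesgue_stieltjes_cdf_id P mX).
case: oX => -[a b] /= _ <-.
have [ab|ba] := leP a b; last first.
  by rewrite set_itv_ge ?measure0// bnd_simp -leNgt ltW.
have -> : `]a, b]%classic = `]-oo, b] `\` `]-oo, a].
  by rewrite -[RHS]setCK setCD setCitvl setUC -[LHS]setCK setCitv.
have PQE x : P `]-oo, x]%classic = Q `]-oo, x]%classic.
  rewrite -[LHS]fineK ?fin_num_measure// -[RHS]fineK ?fin_num_measure//.
  by congr EFin; exact: PQ.
rewrite !measureD ?setIidr//=; try exact: subset_itvl.
- by rewrite !PQE.
- by rewrite -ge0_fin_numE// fin_num_measure.
- by rewrite -ge0_fin_numE// fin_num_measure.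
Qed.

(** [G] prescribes the distribution function on (0, 1) only. Elsewhere the full mass of (0, 1)
    forces the value 0 on the left and 1 on the right, so the two distribution functions agree
    everywhere. *)
Lemma distribution_on01_with_cdf_uniq (R : realType) (G : R -> R)
    (P Q : probability (measurableTypeR R) R) :
  distribution_on01_with_cdf G P -> distribution_on01_with_cdf G Q ->
  forall A : set R, measurable A -> P A = Q A.
Proof.
have cdf0 (S : probability (measurableTypeR R) R) x :
    S `]0, 1[%classic = 1%E -> x <= 0 -> dist_cdf S x = 0.
  move=> S1 x0; rewrite /dist_cdf /cdf /distribution /pushforward preimage_id.
  suff -> : S `]-oo, x]%classic = 0%E by [].
  apply/eqP; rewrite eq_le measure_ge0 andbT.
  have -> : 0%E = S (~` `]0, 1[%classic).
    by rewrite probability_setC// S1 subee.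
  rewrite le_measure ?inE//=; first exact: measurableC.
  move=> y/=; rewrite !in_itv/= => yx; apply/negP.
  by rewrite negb_and -leNgt (le_trans yx).
have cdf1 (S : probability (measurableTypeR R) R) x :
    S `]0, 1[%classic = 1%E -> 1 <= x -> dist_cdf S x = 1.
  move=> S1 x1; rewrite /dist_cdf /cdf /distribution /pushforward preimage_id.
  suff -> : S `]-oo, x]%classic = 1%E by [].
  apply/eqP; rewrite eq_le probability_le1//= -S1 le_measure ?inE//.
  move=> y/=; rewrite !in_itv/= => /andP[_ y1].
  by rewrite (le_trans (ltW y1)).
move=> [P1 PG] [Q1 QG]; apply: probability_eq_cdf => x.
have [x0|x0] := leP x 0; first by rewrite !cdf0.
have [x1|x1] := leP 1 x; first by rewrite !cdf1.
by rewrite PG ?x0// QG ?x0.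
Qed.

(** * Limits at the end points of a nondecreasing bijection of (0, 1) *)

Lemma quantile_cvg_at_right0 (R : realType) (F Q : R -> R) :
  quantile_function_on01 F Q ->
  {in `]0, 1[ &, {homo F : x y / x <= y}} -> F x @[x --> 0^'+] --> (0 : R).
Proof.
move=> [QF FQ] Fle; apply/cvgrPdist_le => e e0.
(* The bound 1/2 keeps [u] inside (0, 1) however large [e] is; for 0 < x < Q u, monotonicity gives F
   x <= F (Q u) = u <= e. *)
pose u : R := Num.min e 2^-1.
have u01 : 0 < u < 1.
  by rewrite lt_min e0 gt_min invr_gt0 ltr0n invf_lt1 ?ltr0n// ltr1n orbT.
have [/andP[Qu0 Qu1] FQu] := QF u u01.
near=> x.
have x0 : 0 < x by near: x; exact: nbhs_right_gt.
have xQ : x < Q u by near: x; exact: nbhs_right_lt.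
have x01 : 0 < x < 1 by rewrite x0 (lt_trans xQ).
have [/andP[Fx0 _] _] := FQ x x01.
rewrite sub0r normrN gtr0_norm//.
have : F x <= F (Q u) by apply: Fle; rewrite ?in_itv/= ?Qu0// ltW.
by rewrite FQu => /le_trans; apply; rewrite ge_min lexx.
Unshelve. all: by end_near. Qed.

Lemma quantile_cvg_at_left1 (R : realType) (F Q : R -> R) :
  quantile_function_on01 F Q ->
  {in `]0, 1[ &, {homo F : x y / x <= y}} -> F x @[x --> 1^'-] --> (1 : R).
Proof.
move=> [QF FQ] Fle; apply/cvgrPdist_le => e e0.
pose u : R := Num.max (1 - e) 2^-1.
have u01 : 0 < u < 1.
  rewrite lt_max gt_max invr_gt0 ltr0n invf_lt1 ?ltr0n// ltr1n orbT andbT/=.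
  by rewrite ltrBlDr ltrDl.
have [/andP[Qu0 Qu1] FQu] := QF u u01.
near=> x.
have x1 : x < 1 by near: x; exact: nbhs_left_lt.
have xQ : Q u < x by near: x; exact: nbhs_left_gt.
have x01 : 0 < x < 1 by rewrite x1 (lt_trans _ xQ).
have [/andP[_ Fx1] _] := FQ x x01.
rewrite gtr0_norm ?subr_gt0// lerBlDl -lerBlDr.
have : F (Q u) <= F x by apply: Fle; rewrite ?in_itv/= ?Qu0// ltW.
by rewrite FQu; apply: le_trans; rewrite le_max lexx.
Unshelve. all: by end_near. Qed.

(** * Existence and density of the distribution with a given differentiable bijection as
    distribution function *)

Section density_on01.
Context (R : realType) (F Q g : R -> R).
Hypothesis FQ : quantile_function_on01 F Q.
Hypothesis g0 : forall x : R, 0 < x < 1 -> 0 <= g x.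
Hypothesis cg : {in `]0, 1[, continuous g}.
Hypothesis dF : forall x : R, 0 < x < 1 -> is_derive x 1 F (g x).

Let F_le : {in `]0, 1[ &, {homo F : x y / x <= y}}.
Proof.
apply: ger0_derive1_le_oo => x.
- by rewrite in_itv/= => x01; have [] := dF x01.
- by rewrite in_itv/= => x01; rewrite derive1E; have [_ ->] := dF x01; exact: g0.
- rewrite inE/= in_itv/= => x01; exact: is_derive_continuous (dF x01).
Qed.

Let mg : measurable_fun (`]0, 1[ : set R) g.
Proof.
apply: open_continuous_measurable_fun => // x; rewrite inE.
exact: cg.
Qed.

(** The fundamental theorem is used twice: on (0, 1), with limits 0 and 1 of [F], it shows that [g]
    has total mass 1; on (0, x) it identifies the distribution function of the resulting probability
    with [F]. *)
Lemma exists_distribution_on01 :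
  exists P : probability (measurableTypeR R) R,
    distribution_on01_with_cdf F P /\
    forall A : set R, measurable A ->
      P A = (\int[lebesgue_measure]_(x in A `&` `]0%R, 1%R[) (g x)%:E)%E.
Proof.
have F0 := quantile_cvg_at_right0 FQ F_le.
have intg1 : (\int[lebesgue_measure]_(x in `]0%R, 1%R[) (g x)%:E = 1)%E.
  rewrite (ge0_continuous_FTC2_oo ltr01 g0 cg dF F0
    (quantile_cvg_at_left1 FQ F_le)).
  by rewrite subr0.
have g0' x : `]0, 1[%classic x -> 0 <= g x by rewrite /= in_itv/=; exact: g0.
have [P PE] := exists_probability_density (measurable_itv _) mg g0' intg1.
exists P; split => //; split => [|x /andP[x0 x1]].
  by rewrite PE// setIid.
rewrite /dist_cdf /cdf /distribution /pushforward preimage_id PE//.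
have -> : `]-oo, x] `&` `]0%R, 1%R[ = `]0, x]%classic.
  apply/seteqP; split => y /=; rewrite !in_itv/=.
    by move=> [yx /andP[-> _]].
  by move=> /andP[-> yx]; rewrite yx (le_lt_trans yx).
(* The end point x has measure zero and is dropped to reach an open interval. *)
rewrite -integral_itv_bndo_bndc; last first.
  apply/measurable_EFinP; apply: measurable_funS mg => //.
  by apply: subset_itvl; rewrite bnd_simp ltW.
have x01 (y : R) : 0 < y < x -> 0 < y < 1.
  by move=> /andP[-> yx]; rewrite (lt_trans yx).
suff -> : (\int[lebesgue_measure]_(y in `]0%R, x[) (g y)%:E = (F x - 0)%:E)%E.
  by rewrite subr0.
apply: (ge0_continuous_FTC2_oo (F := F)) => //.
- by move=> y /x01/g0.
- by move=> y; rewrite in_itv/= => /x01 y01; apply: cg; rewrite in_itv.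
- by move=> y /x01/dF.
- apply: cvg_at_left_filter; apply: is_derive_continuous.
  by apply: dF; rewrite x0.
Qed.

(** By uniqueness [P] coincides with the probability built from [g]. For the derivative,
    [dist_cdf P] and [F] agree on (0, 1), which is open, hence near each of its points. *)
Lemma distribution_on01_pdf (P : probability (measurableTypeR R) R) :
  distribution_on01_with_cdf F P -> pdf_on01 P g.
Proof.
move=> PF; split => //.
- move=> A mA; have [P' [P'F <-//]] := exists_distribution_on01.
  exact: distribution_on01_with_cdf_uniq PF P'F _ mA.
- move=> x x01; apply: near_eq_is_derive (dF x01).
  have [_ PE] := PF.
  have /andP[x0 x1] := x01.
  near=> y; rewrite PE//; apply/andP; split; near: y.
  + exact: lt_nbhsr.
  + exact: lt_nbhsl.
Unshelve. all: by end_near. Qed.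

End density_on01.

(** * Real powers and the Weibull integral *)

Lemma powR_continuous (R : realType) (p x : R) :
  0 < x -> {for x, continuous (fun y : R => y `^ p)}.
Proof. by move=> x0; apply: is_derive_continuous (is_derive1_powR p x0). Qed.

Lemma cvg_powR (R : realType) (T : Type) (F : set_system T) (FF : Filter F)
    (f : T -> R) (p l : R) :
  0 < l -> f x @[x --> F] --> l -> f x `^ p @[x --> F] --> l `^ p.
Proof.
by move=> l0 fl; apply: (@continuous_cvg _ _ _ _ _ f _ _ (powR_continuous l0)).
Qed.

Lemma powR_in01 (R : realType) (p x : R) :
  0 < p -> 0 < x < 1 -> 0 < x `^ p < 1.
Proof.
move=> p0 /andP[x0 x1]; rewrite powR_gt0//=.
have e : 1 `^ p = 1 :> R by rewrite powR1.
by rewrite -[ltRHS]e gt0_ltr_powR ?nnegrE ?ltW.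
Qed.

Lemma powR_gt1 (R : realType) (p x : R) : 0 < p -> 1 < x -> 1 < x `^ p.
Proof.
move=> p0 x1; have e : 1 `^ p = 1 :> R by rewrite powR1.
rewrite -[ltLHS]e.
by rewrite gt0_ltr_powR ?nnegrE ?ler01 ?(le_trans ler01 (ltW x1)).
Qed.

Lemma powRK (R : realType) (p x : R) : p != 0 -> 0 <= x ->
  (x `^ p) `^ (p^-1) = x.
Proof. by move=> p0 x0; rewrite -powRrM divff// powRr1. Qed.

Lemma powRVK (R : realType) (p x : R) : p != 0 -> 0 <= x ->
  (x `^ (p^-1)) `^ p = x.
Proof. by move=> p0 x0; rewrite -powRrM mulVf// powRr1. Qed.

(** The Weibull distribution function of scale 1, meant for y >= 0; the scale enters through the
    argument. *)
Definition weibull1_cdf (R : realType) (c y : R) : R := 1 - expR (- (y `^ c)).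

Lemma is_derive_weibull1_cdf (R : realType) (c y : R) : 0 < y ->
  is_derive y 1 (weibull1_cdf c) (c * y `^ (c - 1) * expR (- (y `^ c))).
Proof.
move=> y0.
have d1 := is_deriveN (is_derive1_powR c y0).
have d2 := @is_derive1_comp _ expR _ _ _ _ (is_derive_expR _) d1.
have d3 := is_deriveB (is_derive_cst (1 : R) y 1) d2.
apply: is_derive_eq d3 _.
by rewrite sub0r mulrN opprK mulrC.
Qed.

(** For c < 1 the density blows up at 0, so the end points are removed and the fundamental theorem
    is applied on (0, q), with limit 0 of the antiderivative at 0. *)
Lemma weibull_pdf_integral (R : realType) (c gamma q : R) :
  0 < c -> 0 < gamma -> 0 < q ->
  \int[lebesgue_measure]_(t in `[0, q]) weibull_pdf c gamma t =
  weibull1_cdf c (q / gamma).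
Proof.
move=> c0 gamma0 q0.
pose F (t : R) := weibull1_cdf c (t / gamma).
(* The density without its case distinction, with factors in the order in which the chain rule
   produces them. *)
pose h (t : R) := c * (t / gamma) `^ (c - 1) * expR (- ((t / gamma) `^ c)) / gamma.
have hE (t : R) : 0 < t -> h t = weibull_pdf c gamma t.
  by move=> t0; rewrite /weibull_pdf /h t0; ring.
have dscale (t : R) : is_derive t 1 (fun s : R => s / gamma) gamma^-1.
  have d := is_deriveM (is_derive_id t (1 : R)) (is_derive_cst gamma^-1 t 1).
  by apply: is_derive_eq d _; rewrite /GRing.scale/= mulr0 add0r mulr1.
have dF (t : R) : 0 < t -> is_derive t 1 F (weibull_pdf c gamma t).
  move=> t0; rewrite -hE//.
  pose G (s : R) := s / gamma.
  exact: (@is_derive1_comp _ _ G _ _ _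
    (is_derive_weibull1_cdf c (divr_gt0 t0 gamma0)) (dscale t)).
have cpdf (t : R) : 0 < t -> {for t, continuous (weibull_pdf c gamma)}.
  move=> t0; have tg0 := divr_gt0 t0 gamma0.
  have cs : s / gamma @[s --> t] --> t / gamma :=
    is_derive_continuous (dscale t).
  have : h s @[s --> t] --> h t.
    apply: cvgM; last exact: cvg_cst.
    apply: cvgM; last first.
      apply: continuous_cvg; [exact: continuous_expR|apply: cvgN].
      exact: cvg_powR.
    apply: cvgM; first exact: cvg_cst.
    exact: cvg_powR.
  rewrite /continuous_at hE//; apply: cvg_trans; apply: near_eq_cvg.
  by near=> s; rewrite hE//; near: s; exact: lt_nbhsr.
have F0 : F t @[t --> 0^'+] --> (0 : R).
  (* Continuity of powers was obtained from differentiability at positive points only. At 0 the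
     factor t^c is split off, so that its limit 0 from the right can be used. *)
  have : 1 - expR (- (t `^ c * gamma^-1 `^ c)) @[t --> 0^'+] -->
      1 - expR (- (0 * gamma^-1 `^ c)).
    apply: cvgB; first exact: cvg_cst.
    apply: continuous_cvg; [exact: continuous_expR|apply: cvgN].
    by apply: cvgM; [exact: powR_cvg0|exact: cvg_cst].
  rewrite mul0r oppr0 expR0 subrr.
  apply: cvg_trans; apply: near_eq_cvg; near=> t.
  by rewrite /F /weibull1_cdf powRM// ?invr_ge0 ltW.
rewrite /Rintegral integral_itv_bndoo//; last first.
  apply/measurable_EFinP; apply: open_continuous_measurable_fun => // t.
  by rewrite inE/= in_itv/= => /andP[+ _]; exact: cpdf.
suff -> : (\int[lebesgue_measure]_(t in `]0%R, q[) (weibull_pdf c gamma t)%:E =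
    (F q - 0)%:E)%E by rewrite subr0.
apply: (ge0_continuous_FTC2_oo (F := F)) => //.
- move=> t /andP[t0 _]; rewrite -hE// /h.
  by rewrite !mulr_ge0 ?expR_ge0 ?powR_ge0 ?invr_ge0 ?ltW.
- by move=> t; rewrite in_itv/= => /andP[+ _]; exact: cpdf.
- by move=> t /andP[+ _]; exact: dF.
- by apply: cvg_at_left_filter; exact: is_derive_continuous (dF _ q0).
Unshelve. all: by end_near. Qed.

(** * The Weibull-Kumaraswamy-Lomax distribution on (0, 1) *)

Section weibull_kumaraswamy_lomax.
Context (R : realType) (a b c gamma alpha lambda : R).
Hypotheses (a0 : 0 < a) (b0 : 0 < b) (c0 : 0 < c).
Hypotheses (gamma0 : 0 < gamma) (alpha0 : 0 < alpha) (lambda0 : 0 < lambda).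

(** This is Q_Y(F_X(x)) / gamma on (0, 1): there 1 - F_X(x) = (1 - x^a)^b, and the Lomax exponent
    -1/alpha merges with b into -b/alpha. *)
Definition wkl_z (x : R) :=
  lambda * ((1 - x `^ a) `^ (- (b / alpha)) - 1) / gamma.

Let ba0 : 0 < b / alpha. Proof. by rewrite divr_gt0. Qed.

Let t01 (x : R) : 0 < x < 1 -> 0 < 1 - x `^ a < 1.
Proof.
move=> /(powR_in01 a0) /andP[? ?].
by rewrite subr_gt0 ltrBlDr ltrDl; apply/andP.
Qed.

(** A negative power of a number in (0, 1) exceeds 1. Positivity makes y^c differentiable at y =
    z(x) and the c-th root an inverse there. *)
Lemma wkl_z_gt0 (x : R) : 0 < x < 1 -> 0 < wkl_z x.
Proof.
move=> /t01 tx; have /andP[h0 h1] := powR_in01 ba0 tx.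
by rewrite /wkl_z divr_gt0// mulr_gt0// subr_gt0 powRN invf_gt1.
Qed.

Lemma wkl_G_closed_form (x : R) : 0 < x < 1 ->
  wkl_G a b c gamma alpha lambda x = weibull1_cdf c (wkl_z x).
Proof.
move=> x01; rewrite /wkl_G.
have -> : lomax_quantile alpha lambda (kumaraswamy_cdf a b x) =
    wkl_z x * gamma.
  rewrite /lomax_quantile /kumaraswamy_cdf subKr -powRrM /wkl_z divfK ?gt_eqF//.
  by rewrite mulrN mulrA mulr1.
by rewrite weibull_pdf_integral ?mulfK ?gt_eqF// mulr_gt0// wkl_z_gt0.
Qed.

Definition wkl_pdf (x : R) := a * b * c * lambda / (alpha * gamma)
      * x `^ (a - 1) * (1 - x `^ a) `^ (- 1 - b / alpha)
      * (wkl_z x) `^ (c - 1) * expR (- (wkl_z x `^ c)).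

Lemma is_derive_wkl_z (x : R) : 0 < x < 1 -> is_derive x 1 wkl_z
  (a * b * lambda / (alpha * gamma)
      * x `^ (a - 1) * (1 - x `^ a) `^ (- 1 - b / alpha)).
Proof.
move=> /[dup] /andP[x0 _] /t01/andP[t0 _].
have d1 := is_deriveB (is_derive_cst (1 : R) x 1) (is_derive1_powR a x0).
have d2 := @is_derive1_comp _ _ (cst 1 - (@powR R)^~ a) _ _ _
  (is_derive1_powR (- (b / alpha)) t0) d1.
have d3 := is_deriveB d2 (is_derive_cst (1 : R) x 1).
have d4 := is_deriveM (is_deriveM (is_derive_cst lambda x 1) d3)
  (is_derive_cst gamma^-1 x 1).
apply: is_derive_eq d4 _.
(* The minus sign of the exponent -b/alpha cancels that of the derivative of 1 - x^a. *)
rewrite /GRing.scale/= [- (b / alpha) - 1]addrC subr0 sub0r.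
have -> : (alpha * gamma)^-1 = alpha^-1 * gamma^-1 by rewrite invfM.
ring.
Qed.

Lemma is_derive_wkl_cdf (x : R) : 0 < x < 1 ->
  is_derive x 1 (weibull1_cdf c \o wkl_z) (wkl_pdf x).
Proof.
move=> x01.
have d := @is_derive1_comp _ _ wkl_z _ _ _
  (is_derive_weibull1_cdf c (wkl_z_gt0 x01)) (is_derive_wkl_z x01).
by apply: is_derive_eq d _; rewrite /wkl_pdf; ring.
Qed.

Lemma wkl_pdf_ge0 (x : R) : 0 < x < 1 -> 0 <= wkl_pdf x.
Proof.
move=> x01; rewrite /wkl_pdf.
by rewrite !mulr_ge0 ?invr_ge0 ?mulr_ge0 ?expR_ge0 ?powR_ge0 ?ltW.
Qed.

Lemma wkl_pdf_continuous : {in `]0, 1[, continuous wkl_pdf}.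
Proof.
move=> x; rewrite in_itv/= => x01.
have /andP[x0 _] := x01; have /andP[t0 _] := t01 x01.
have ct : 1 - y `^ a @[y --> x] --> 1 - x `^ a.
  by apply: cvgB; [exact: cvg_cst|exact: powR_continuous].
have cz : wkl_z y @[y --> x] --> wkl_z x :=
  is_derive_continuous (is_derive_wkl_z x01).
have z0 := wkl_z_gt0 x01.
apply: cvgM; last first.
  apply: continuous_cvg; [exact: continuous_expR|apply: cvgN].
  exact: cvg_powR.
apply: cvgM; last exact: cvg_powR.
apply: cvgM; last exact: cvg_powR.
apply: cvgM; first exact: cvg_cst.
exact: powR_continuous.
Qed.

Lemma wkl_quantile : quantile_function_on01 (weibull1_cdf c \o wkl_z)
           (fun u : R =>
              (1 - (1 + gamma / lambda * (- ln (1 - u)) `^ (1 / c))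
                     `^ (- (alpha / b))) `^ (1 / a)).
Proof.
have an0 : a != 0 by rewrite gt_eqF.
have cn0 : c != 0 by rewrite gt_eqF.
have ban0 : b / alpha != 0 by rewrite gt_eqF.
have gn0 : gamma != 0 by rewrite gt_eqF.
have ln0 : lambda != 0 by rewrite gt_eqF.
have abE : alpha / b = (b / alpha)^-1 by rewrite invf_div.
split=> [u /andP[u0 u1]|x x01].
(* The intermediate values of the inversion: [w] will be z(Q u), and [s] below will be (1 - (Q
   u)^a)^(-b/alpha). *)
- set w := (- ln (1 - u)) `^ (1 / c).
  have L0 : 0 < - ln (1 - u).
    by rewrite oppr_gt0 ln_lt0// subr_gt0 u1 ltrBlDr ltrDl.
  have w0 : 0 < w by exact: powR_gt0.
  set s := 1 + gamma / lambda * w.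
  have s1 : 1 < s by rewrite ltrDl mulr_gt0// divr_gt0.
  have s0 : 0 < s by exact: lt_trans s1.
  (* Since s > 1, this negative power lies in (0, 1), hence so do 1 minus it and the a-th root
     [Q u]. *)
  have p01 : 0 < s `^ (- (alpha / b)) < 1.
    rewrite powR_gt0//= powRN invf_lt1 ?powR_gt0// powR_gt1//.
    by rewrite divr_gt0.
  have r01 : 0 < 1 - s `^ (- (alpha / b)) < 1.
    by move: p01 => /andP[? ?]; apply/andP; split; lra.
  have r0 : 0 <= 1 - s `^ (- (alpha / b)) by move: r01 => /andP[/ltW].
  split; first by apply: powR_in01 => //; rewrite divr_gt0.
  rewrite /= /wkl_z div1r powRVK// subKr -powRrM mulrNN abE mulVf// powRr1 ?ltW//.
  have -> : lambda * (s - 1) / gamma = w.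
    by rewrite /s; field; apply/andP.
  rewrite /weibull1_cdf /w div1r powRVK// ?ltW// opprK lnK ?subKr//.
  by rewrite posrE subr_gt0.
- have z0 := wkl_z_gt0 x01; have /andP[t0 _] := t01 x01; have /andP[x0 _] := x01.
  split.
    apply/andP; split; rewrite /= /weibull1_cdf.
      by rewrite subr_gt0 expR_lt1 oppr_lt0 powR_gt0.
    by rewrite gtrBl expR_gt0.
  (* Conversely, -ln(1 - F x) = z(x)^c, whose c-th root is z(x); undoing the affine map and then the
     power -b/alpha leaves 1 - x^a. *)
  rewrite /= /weibull1_cdf subKr expRK opprK !div1r powRK// ?ltW//.
  have -> : 1 + gamma / lambda * wkl_z x = (1 - x `^ a) `^ (- (b / alpha)).
    by rewrite /wkl_z; field; apply/andP.
  rewrite -powRrM mulrNN abE divff// powRr1 ?ltW// subKr.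
  by rewrite powRK// ltW.
Qed.

End weibull_kumaraswamy_lomax.

(** * The four formulas *)

Theorem mainTheorem1 (R : realType) (a b c gamma alpha lambda : R)
    (ha : 0 < a) (hb : 0 < b) (hc : 0 < c)
    (hgamma : 0 < gamma) (halpha : 0 < alpha) (hlambda : 0 < lambda) :
  let G := wkl_G a b c gamma alpha lambda in
  let g := fun x : R =>
    a * b * c * lambda / (alpha * gamma)
      * x `^ (a - 1) * (1 - x `^ a) `^ (- 1 - b / alpha)
      * (lambda * ((1 - x `^ a) `^ (- (b / alpha)) - 1) / gamma) `^ (c - 1)
      * expR (- ((lambda * ((1 - x `^ a) `^ (- (b / alpha)) - 1) / gamma)
                   `^ c)) in
  (exists P : probability (measurableTypeR R) R,
     distribution_on01_with_cdf G P) /\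
  (forall P : probability (measurableTypeR R) R,
     distribution_on01_with_cdf G P ->
     [/\ forall x : R, 0 < x < 1 ->
           dist_cdf P x = G x /\
           G x = 1 - expR (- ((lambda * ((1 - x `^ a) `^ (- (b / alpha)) - 1)
                                 / gamma) `^ c)),
         pdf_on01 P g,
         quantile_function_on01 (dist_cdf P)
           (fun u : R =>
              (1 - (1 + gamma / lambda * (- ln (1 - u)) `^ (1 / c))
                     `^ (- (alpha / b))) `^ (1 / a))
       & forall x : R, 0 < x < 1 ->
           hazard (dist_cdf P) g x =
           a * b * c * lambda / (alpha * gamma)
             * x `^ (a - 1) * (1 - x `^ a) `^ (- 1 - b / alpha)
             * (lambda * ((1 - x `^ a) `^ (- (b / alpha)) - 1) / gamma)
                 `^ (c - 1)]).
Proof.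
move=> G g.
(* [F] agrees with [G] on (0, 1), and [distribution_on01_with_cdf] looks at no other points, so [F]
   can replace [G]. *)
pose F := weibull1_cdf c \o wkl_z a b gamma alpha lambda.
have GE x : 0 < x < 1 -> G x = F x by exact: wkl_G_closed_form.
have GF P : distribution_on01_with_cdf G P -> distribution_on01_with_cdf F P.
  by move=> [P1 PG]; split=> // x x01; rewrite PG// GE.
have FQ := wkl_quantile ha hb hc hgamma halpha hlambda.
(* Here [g] is [wkl_pdf] with [wkl_z] unfolded, so the lemmas of the section apply by conversion. *)
have g0 (x : R) : 0 < x < 1 -> 0 <= g x.
  exact: wkl_pdf_ge0.
have cg : {in `]0, 1[, continuous g} by exact: wkl_pdf_continuous.
have dF (x : R) : 0 < x < 1 -> is_derive x 1 F (g x).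
  exact: is_derive_wkl_cdf.
split.
  have [P [[P1 PF] _]] := exists_distribution_on01 FQ g0 cg dF.
  by exists P; split=> // x x01; rewrite PF// GE.
move=> P /GF PF; have [_ PE] := PF; split.
- by move=> x x01; rewrite PE// GE.
- exact: distribution_on01_pdf FQ g0 cg dF _ PF.
- split=> [u u01|x x01]; last by rewrite PE//; exact: FQ.2.
  by have [Qu01 FQu] := FQ.1 _ u01; split=> //; rewrite PE.
(* The survival function 1 - F is exactly the exponential factor of [g], which is nonzero and
   cancels. *)
- move=> x x01; rewrite /hazard PE// /F /= /weibull1_cdf subKr.
  by rewrite mulfK// gt_eqF// expR_gt0.
Qed.
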